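(* Let $T$ be a triangle in the plane of area $1$, and let $p_1,\dots,p_5$ be five points in $T$. Then there exist three of these points, $p_i,p_j,p_k$ with $i,j,k$ distinct, such that the triangle $p_ip_jp_k$ has area at most $6/25$.
   Context: The triangle $T$ is regarded as a closed region (points may lie on its boundary). The area of the triangle formed by three collinear points is $0$. *)

(* Defs.v *)
From mathcomp Require Import all_boot all_order all_algebra.
From mathcomp Require Import classical_sets reals.

Set Implicit Arguments.
Unset Strict Implicit.
Unset Printing Implicit Defensive.

Import Order.TTheory GRing.Theory Num.Theory.
Local Open Scope ring_scope.
Local Open Scope classical_set_scope.

(* The closed region bounded by the triangle abc: all convex combinations of
   its vertices. *)
Definition triangle (R : realType) (a b c : 'rV[R]_2) : set 'rV[R]_2 :=
  [set x | exists u v w : R,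
    [/\ 0 <= u, 0 <= v, 0 <= w, u + v + w = 1
      & x = u *: a + v *: b + w *: c] ].

(* Half the absolute value of the cross product of b - a and c - a; it is 0
   exactly when a, b, c are collinear. *)
Definition triangle_area (R : realType) (a b c : 'rV[R]_2) : R :=
  `| (b 0 0 - a 0 0) * (c 0 1 - a 0 1)
     - (c 0 0 - a 0 0) * (b 0 1 - a 0 1) | / 2.

(* Main.v *)
Require Import Defs.
From mathcomp Require Import all_boot all_order all_algebra.
From mathcomp Require Import classical_sets reals.
From mathcomp Require Import ring lra.

(* Suppose that all ten triangles have area greater than m = 6/25.
   If two points lie in the triangle spanned by the other three, that triangle
   splits into five triangles, so 5m < 1, which is false.
   If the hull is a quadrilateral a b c d with the fifth point inside, then two
   triangles on a common side a b contain that point and have area above 3m,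
   while the two on the opposite side have area above m; the quadrilateral then
   contains a trapezoid that is too large for T.
   If the hull is a pentagon, let M be the largest triangle formed by a side and
   the opposite vertex.  A Pluecker relation gives a second such triangle K,
   sharing a diagonal with M, such that K^2 >= m^2 + m M.  The trapezoid inside the
   corresponding quadrilateral, together with the fifth point across the
   diagonal, is again too large for T.
   Points are written in the barycentric coordinates of T, with the first one
   dropped. *)

Import Order.TTheory GRing.Theory Num.Theory.
Local Open Scope ring_scope.
Local Open Scope classical_set_scope.

Set Implicit Arguments.
Unset Strict Implicit.
Unset Printing Implicit Defensive.

(** * Signed areas and parallel segments *)

Section Cross.
Variable R : realFieldType.
Implicit Types (p q r s t : R * R) (l : R).

Definition simplex p : Prop := [/\ 0 <= p.1, 0 <= p.2 & p.1 + p.2 <= 1].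

(** Twice the Euclidean signed area, so that [simplex] itself has area 1, like T. *)
Definition cross p q r : R :=
  (q.1 - p.1) * (r.2 - p.2) - (r.1 - p.1) * (q.2 - p.2).

Definition shift r l p q : R * R :=
  (r.1 + l * (q.1 - p.1), r.2 + l * (q.2 - p.2)).

Lemma cross_rot p q r : cross r p q = cross p q r.
Proof. by rewrite /cross; ring. Qed.

Lemma cross_swap p q r : cross q p r = - cross p q r.
Proof. by rewrite /cross; ring. Qed.

End Cross.

Ltac crosses :=
  match goal with |- is_true (_ < cross ?x ?y ?z) =>
    have := cross_rot x y z; have := cross_rot z x y; have := cross_swap x y z;
    have := cross_rot y x z; have := cross_rot z y x; lra
  end.

Ltac rotate_to x :=
  repeat match goal with |- context [cross ?u ?v x] =>
    rewrite -(cross_rot u v x)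
  end.

(** * Area of a pentagon in the simplex *)

Section SimplexPoints.
Variable R : realFieldType.
Implicit Types (a b c d p q r s t : R * R) (l : R).

(** The shoelace area, cut into a fan at [p]; repeating the last point gives quadrilaterals and
    triangles. *)
Definition pentagon_area p q r s t : R :=
  cross p q r + cross p r s + cross p s t.

Lemma pentagon_area_origin q r s t :
  simplex q -> simplex r -> simplex s -> simplex t ->
  pentagon_area (0, 0) q r s t <= 1.
Proof.
move=> [q1 q2 q12] [r1 r2 r12] [s1 s2 s12] [t1 t2 t12].
(* These five products add up to 1 minus the area. *)
have h1 : 0 <= (1 - q.1) * r.2 by apply: mulr_ge0; lra.
have h2 : 0 <= r.1 * q.2 by apply: mulr_ge0.
have h3 : 0 <= (1 - s.1 - s.2) * (1 - r.2) by apply: mulr_ge0; lra.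
have h4 : 0 <= s.1 * (1 - t.2) by apply: mulr_ge0; lra.
have h5 : 0 <= s.2 * (1 - r.2 - r.1 + t.1) by apply: mulr_ge0; lra.
by rewrite /pentagon_area /cross /=; lra.
Qed.

(* The affine map that permutes the vertices of the simplex cyclically. *)
Definition turn p : R * R := (p.2, 1 - p.1 - p.2).

Lemma simplex_turn p : simplex p -> simplex (turn p).
Proof. by case=> ? ? ?; split=> /=; lra. Qed.

Lemma pentagon_area_turn p q r s t :
  pentagon_area (turn p) (turn q) (turn r) (turn s) (turn t)
  = pentagon_area p q r s t.
Proof. by rewrite /pentagon_area /cross /=; ring. Qed.

(* The area is affine in [p], so it is enough to place [p] at a vertex. *)
Lemma pentagon_area_le1 p q r s t :
  simplex p -> simplex q -> simplex r -> simplex s -> simplex t ->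
  pentagon_area p q r s t <= 1.
Proof.
move=> [p1 p2 p12] hq hr hs ht.
have f0_le := pentagon_area_origin hq hr hs ht.
have turn1 : turn (1, 0) = (0, 0) by rewrite /turn /= subrr subr0.
have turn2 : turn (0, 1) = (1, 0) by rewrite /turn /= subr0 subrr.
have f1_le : pentagon_area (1, 0) q r s t <= 1.
  rewrite -pentagon_area_turn turn1.
  by apply: pentagon_area_origin; apply: simplex_turn.
have f2_le : pentagon_area (0, 1) q r s t <= 1.
  rewrite -2!pentagon_area_turn turn2 turn1.
  by apply: pentagon_area_origin; do 2!apply: simplex_turn.
have -> : pentagon_area p q r s t
    = (1 - p.1 - p.2) * pentagon_area (0, 0) q r s t
      + p.1 * pentagon_area (1, 0) q r s t + p.2 * pentagon_area (0, 1) q r s t.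
  by rewrite /pentagon_area /cross /=; ring.
set f0 := pentagon_area (0, 0) _ _ _ _ in f0_le *.
set f1 := pentagon_area (1, 0) _ _ _ _ in f1_le *.
set f2 := pentagon_area (0, 1) _ _ _ _ in f2_le *.
have h1 : 0 <= p.1 * (1 - f1) by apply: mulr_ge0 => //; lra.
have h2 : 0 <= p.2 * (1 - f2) by apply: mulr_ge0 => //; lra.
have h0 : 0 <= (1 - p.1 - p.2) * (1 - f0) by apply: mulr_ge0; lra.
lra.
Qed.

(** * Trapezoids and chords in the simplex *)

(** The case where two barycentric coordinates [d1], [d2] of [q - p] are nonnegative. The right side
    minus the left is exactly the sum of the products [h1] to [h6]. *)
Lemma trapezoid_coord (p1 p2 d1 d2 r1 r2 t1 t2 : R) l :
    0 <= l <= 1 -> 0 <= p1 -> 0 <= p2 -> 0 <= d1 -> 0 <= d2 ->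
    0 <= r1 -> 0 <= r2 -> 0 <= t1 -> 0 <= t2 ->
    p1 + p2 + (d1 + d2) <= 1 -> r1 + r2 + l * (d1 + d2) <= 1 -> t1 + t2 <= 1 ->
  d2 * (p1 - r1) + d1 * (r2 - p2)
    + (1 - l) * (d2 * (t1 - p1) + d1 * (p2 - t2))
  <= (d1 + d2) * (1 - l * (d1 + d2)).
Proof.
move=> /andP[l0 l1] p10 p20 d10 d20 r10 r20 t10 t20 hp hr ht.
have l1' : 0 <= 1 - l by lra.
have h1 : 0 <= l * d2 * (1 - (d1 + d2) - p1).
  by apply: mulr_ge0; [apply: mulr_ge0 | lra].
have h2 : 0 <= l * d1 * p2 by do !apply: mulr_ge0.
have h3 : 0 <= d1 * (1 - l * (d1 + d2) - r2) by apply: mulr_ge0 => //; lra.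
have h4 : 0 <= (1 - l) * d2 * (1 - t1).
  by apply: mulr_ge0; [apply: mulr_ge0 | lra].
have h5 : 0 <= d2 * r1 by apply: mulr_ge0.
have h6 : 0 <= (1 - l) * d1 * t2 by do !apply: mulr_ge0.
nra.
Qed.

(* [p q] and [r (shift r l p q)] are the bases of a trapezoid; [e] is the
   length of [p q] measured by the largest barycentric coordinate of [q - p]. *)
Lemma trapezoid_le p q r t l :
    0 <= l <= 1 -> simplex p -> simplex q -> simplex r -> simplex t ->
    simplex (shift r l p q) ->
  exists2 e, 0 <= e <= 1 &
    cross p q r - (1 - l) * cross p q t <= e * (1 - l * e).
Proof.
move=> hl; case: p q r t => [p1 p2] [q1 q2] [r1 r2] [t1 t2].
rewrite /simplex /shift /cross /= => -[? ? ?] [? ? ?] [? ? ?] [? ? ?] [? ? ?].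
pose p3 : R := 1 - p1 - p2; pose q3 : R := 1 - q1 - q2; pose r3 : R := 1 - r1 - r2.
pose t3 : R := 1 - t1 - t2.
pose s1 := r1 + l * (q1 - p1); pose s2 := r2 + l * (q2 - p2).
pose s3 : R := r3 + l * (q3 - p3).
have unfolds : (p3 = 1 - p1 - p2) * (q3 = 1 - q1 - q2) * (r3 = 1 - r1 - r2)
    * (t3 = 1 - t1 - t2) * (s1 = r1 + l * (q1 - p1)) * (s2 = r2 + l * (q2 - p2))
    * (s3 = 1 - r1 - r2 + l * (p1 + p2 - q1 - q2)).
  by do !split=> //; rewrite /s3 /r3 /q3 /p3; ring.
clearbody p3 q3 r3 t3 s1 s2 s3.
(* The barycentric coordinates of [q - p] sum to 0, so two of them share a sign. Two nonnegative
   ones are used in cyclic order; for two nonpositive ones [p q] is reversed, [s] replaces [r], and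
   the opposite order restores the orientation. *)
have [d1|d1] := lerP p1 q1; have [d2|d2] := lerP p2 q2.
- exists (q1 - p1 + (q2 - p2)); first lra.
  apply: le_trans; last apply: (@trapezoid_coord p1 p2 _ _ r1 r2 t1 t2 l) => //; lra.
- have [d3|d3] := lerP (q1 + q2) (p1 + p2).
  + exists (q3 - p3 + (q1 - p1)); first by rewrite !unfolds; lra.
    apply: le_trans; last apply: (@trapezoid_coord p3 p1 _ _ r3 r1 t3 t1 l) => //;
      rewrite ?unfolds; lra.
  + exists (p3 - q3 + (p2 - q2)); first by rewrite !unfolds; lra.
    apply: le_trans; last apply: (@trapezoid_coord q3 q2 _ _ s3 s2 t3 t2 l) => //;
      rewrite ?unfolds; lra.
- have [d3|d3] := lerP (q1 + q2) (p1 + p2).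
  + exists (q2 - p2 + (q3 - p3)); first by rewrite !unfolds; lra.
    apply: le_trans; last apply: (@trapezoid_coord p2 p3 _ _ r2 r3 t2 t3 l) => //;
      rewrite ?unfolds; lra.
  + exists (p1 - q1 + (p3 - q3)); first by rewrite !unfolds; lra.
    apply: le_trans; last apply: (@trapezoid_coord q1 q3 _ _ s1 s3 t1 t3 l) => //;
      rewrite ?unfolds; lra.
- exists (p2 - q2 + (p1 - q1)); first lra.
  apply: le_trans; last apply: (@trapezoid_coord q2 q1 _ _ s2 s1 t2 t1 l) => //;
    rewrite ?unfolds; lra.
Qed.

(** Mirror image of [trapezoid_le]: exchanging the two coordinates negates [cross]. *)
Lemma trapezoid_ge p q r t l :
    0 <= l <= 1 -> simplex p -> simplex q -> simplex r -> simplex t ->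
    simplex (shift r l p q) ->
  exists2 e, 0 <= e <= 1 &
    (1 - l) * cross p q t - cross p q r <= e * (1 - l * e).
Proof.
pose swap (a : R * R) := (a.2, a.1).
have simplex_swap a : simplex a -> simplex (swap a).
  by case=> ? ? ?; split=> //=; rewrite addrC.
have crossE a b c : cross a b c = - cross (swap a) (swap b) (swap c).
  by rewrite /cross /=; ring.
move=> hl /simplex_swap hp /simplex_swap hq /simplex_swap hr /simplex_swap ht.
move=> /simplex_swap hs; have [e he le] := trapezoid_le hl hp hq hr ht hs.
by exists e => //; rewrite (crossE p q r) (crossE p q t); lra.
Qed.

(* The point [shift d l a b] lies on the chord of the quadrilateral [a b c d]
   through [d] parallel to [a b]. *)
Lemma simplex_shift_last a b c d l :
    simplex b -> simplex c -> simplex d ->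
    0 <= cross a b d <= cross a b c -> 0 < cross a b c -> 0 < cross b c d ->
    0 <= l -> l * cross a b c <= cross b c d ->
  simplex (shift d l a b).
Proof.
move=> hb hc hd /andP[K0 KK'] K'0 a0 l0 hl.
(* The shifted point is a convex combination of [b], [c], [d], so it inherits every affine
   inequality that they satisfy. *)
have affine_ge0 f0 f1 f2 :
    0 <= f0 + f1 * b.1 + f2 * b.2 -> 0 <= f0 + f1 * c.1 + f2 * c.2 ->
    0 <= f0 + f1 * d.1 + f2 * d.2 ->
  0 <= f0 + f1 * (shift d l a b).1 + f2 * (shift d l a b).2.
  move=> fb fc fd; rewrite -(pmulr_rge0 _ (mulr_gt0 a0 K'0)).
  have -> : cross b c d * cross a b c
              * (f0 + f1 * (shift d l a b).1 + f2 * (shift d l a b).2)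
      = cross a b c * ((cross b c d - l * cross a b c)
                         * (f0 + f1 * d.1 + f2 * d.2)
          + l * (cross a b d * (f0 + f1 * c.1 + f2 * c.2)
                 + (cross a b c - cross a b d) * (f0 + f1 * b.1 + f2 * b.2))).
    by rewrite /cross /shift /=; ring.
  apply: mulr_ge0 (ltW K'0) (addr_ge0 (mulr_ge0 _ fd) (mulr_ge0 l0
    (addr_ge0 (mulr_ge0 K0 fc) (mulr_ge0 _ fb)))); lra.
move: hb hc hd => [? ? ?] [? ? ?] [? ? ?]; split.
- by have : 0 <= 0 + 1 * (shift d l a b).1 + 0 * (shift d l a b).2;
    [apply: affine_ge0; lra | lra].
- by have : 0 <= 0 + 0 * (shift d l a b).1 + 1 * (shift d l a b).2;
    [apply: affine_ge0; lra | lra].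
- by have : 0 <= 1 + (-1) * (shift d l a b).1 + (-1) * (shift d l a b).2;
    [apply: affine_ge0; lra | lra].
Qed.

(** Mirror image of [simplex_shift_last]: [a] trades places with [b], and [c] with [d]. *)
Lemma simplex_shift_third a b c d l :
    simplex a -> simplex c -> simplex d ->
    0 <= cross a b c <= cross a b d -> 0 < cross a b d -> 0 < cross a c d ->
    0 <= l -> l * cross a b d <= cross a c d ->
  simplex (shift c l b a).
Proof.
move=> ha hc hd /andP[K0 KK'] K'0 b0 l0 hl.
have affine_ge0 f0 f1 f2 :
    0 <= f0 + f1 * a.1 + f2 * a.2 -> 0 <= f0 + f1 * c.1 + f2 * c.2 ->
    0 <= f0 + f1 * d.1 + f2 * d.2 ->
  0 <= f0 + f1 * (shift c l b a).1 + f2 * (shift c l b a).2.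
  move=> fa fc fd; rewrite -(pmulr_rge0 _ (mulr_gt0 b0 K'0)).
  have -> : cross a c d * cross a b d
              * (f0 + f1 * (shift c l b a).1 + f2 * (shift c l b a).2)
      = cross a b d * ((cross a c d - l * cross a b d)
                         * (f0 + f1 * c.1 + f2 * c.2)
          + l * (cross a b c * (f0 + f1 * d.1 + f2 * d.2)
                 + (cross a b d - cross a b c) * (f0 + f1 * a.1 + f2 * a.2))).
    by rewrite /cross /shift /=; ring.
  apply: mulr_ge0 (ltW K'0) (addr_ge0 (mulr_ge0 _ fc) (mulr_ge0 l0
    (addr_ge0 (mulr_ge0 K0 fd) (mulr_ge0 _ fa)))); lra.
move: ha hc hd => [? ? ?] [? ? ?] [? ? ?]; split.
- by have : 0 <= 0 + 1 * (shift c l b a).1 + 0 * (shift c l b a).2;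
    [apply: affine_ge0; lra | lra].
- by have : 0 <= 0 + 0 * (shift c l b a).1 + 1 * (shift c l b a).2;
    [apply: affine_ge0; lra | lra].
- by have : 0 <= 1 + (-1) * (shift c l b a).1 + (-1) * (shift c l b a).2;
    [apply: affine_ge0; lra | lra].
Qed.

(** * Numerical contradictions for each kind of hull *)

Lemma quad_false a b c d :
    simplex a -> simplex b -> simplex c -> simplex d ->
    18 / 25 < cross a b c -> 18 / 25 < cross a b d ->
    6 / 25 < cross b c d -> 6 / 25 < cross a c d ->
  False.
Proof.
move=> ha hb hc hd hK' hK hA hB.
have S : cross a b c + cross a c d <= 1.
  have := pentagon_area_le1 ha hb hc hd hd.
  by rewrite /pentagon_area (_ : cross a d d = 0) ?addr0 // /cross; ring.
have S' : cross a b c + cross a c d = cross a b d + cross b c d.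
  by rewrite /cross; ring.
(* The total area is at most 1, so both triangles on [a b] are below 19/25, and the chord ratio
   (6/25)/(19/25) = 6/19 is available. The bound is attained at [e = 1], and 13/19 < 18/25. *)
have bound (e : R) : 0 <= e <= 1 -> e * (1 - 6 / 19 * e) <= 13 / 19.
  by move=> /andP[? ?]; have : 0 <= (1 - e) * (13 / 19 - 6 / 19 * e);
    [apply: mulr_ge0; lra | lra].
have l01 : 0 <= (6 / 19 : R) <= 1 by lra.
have [KK'|KK'] := lerP (cross a b d) (cross a b c).
- have hs : simplex (shift d (6 / 19) a b).
    by apply: (@simplex_shift_last a b c d) => //; lra.
  have [e /bound he] := trapezoid_le l01 ha hb hd ha hs.
  by rewrite (_ : cross a b a = 0); [lra | rewrite /cross; ring].
- have hs : simplex (shift c (6 / 19) b a).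
    by apply: (@simplex_shift_third a b c d) => //; lra.
  have [e /bound he] := trapezoid_ge l01 hb ha hc ha hs.
  rewrite (_ : cross b a a = 0); last by rewrite /cross; ring.
  by rewrite cross_swap; lra.
Qed.

Lemma pentagon_num_false (K M e l : R) :
    0 < K -> K <= M -> M <= 13 / 25 -> 36 / 625 + 6 / 25 * M <= K ^+ 2 ->
    l * M = 6 / 25 -> 0 <= e <= 1 ->
    K + (1 - l) * (6 / 25) <= e * (1 - l * e) ->
  False.
Proof.
move=> K0 KM M1 hK lM /andP[e0 e1] h.
(* With m = 6/25, K^2 >= m^2 + m K, so K is at least m times the golden ratio; 97/250 rounds this
   down. *)
have K1 : 97 / 250 <= K by nra.
have M0 : 0 < M by lra.
have hM : K * M + (M - 6 / 25) * (6 / 25) <= e * (M - 6 / 25 * e).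
  have : M * (K + (1 - l) * (6 / 25)) <= M * (e * (1 - l * e)).
    by rewrite ler_pM2l.
  rewrite (_ : M * (K + _) = K * M + (M - l * M) * (6 / 25)); last by ring.
  rewrite (_ : M * (e * _) = e * (M - l * M * e)); last by ring.
  by rewrite lM.
(* The right side of [hM] is quadratic in [e] and peaks at [e = M / (12/25)]. For larger [M] the
   peak leaves [0, 1] and [e = 1] is the worst case. *)
have [M2|M2] := lerP M (12 / 25).
- have : 0 <= (M - 12 / 25 * e) ^+ 2 by apply: sqr_ge0.
  have : 0 <= (M - 97 / 250) * (12 / 25 - M) by apply: mulr_ge0; lra.
  have : 0 <= (K - 97 / 250) * M by apply: mulr_ge0; lra.
  lra.
(* Here K^2 >= 3 m^2, and 83/200 rounds m sqrt(3) down. *)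
- have K2 : 83 / 200 <= K by nra.
  have : 0 <= (1 - e) * (M - 6 / 25 - 6 / 25 * e) by apply: mulr_ge0; lra.
  have : 0 <= (K - 83 / 200) * M by apply: mulr_ge0; lra.
  lra.
Qed.

(* The larger of [cross p q s] and [cross p r t] is the area K of the header;
   it decides which of the diagonals [p s] and [p r] is the long base. *)
Lemma pentagon_max_false p q r s t :
    simplex p -> simplex q -> simplex r -> simplex s -> simplex t ->
    6 / 25 < cross p q r -> 6 / 25 < cross q r s -> 6 / 25 < cross r s t ->
    6 / 25 < cross p s t -> 6 / 25 < cross p q t ->
    0 < cross p q s -> 0 < cross p r t ->
    cross p q s <= cross p r s -> cross p r t <= cross p r s ->
  False.
Proof.
move=> hp hq hr hs ht pqr qrs rst pst pqt pqs prt pqsM prtM.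
have S := pentagon_area_le1 hp hq hr hs ht; rewrite /pentagon_area in S.
have plucker : cross p q s * cross p r t
    = cross p q r * cross p s t + cross p q t * cross p r s.
  by rewrite /cross; ring.
set M := cross p r s in plucker pqsM prtM S *.
have prod_ge : 36 / 625 + 6 / 25 * M <= cross p q s * cross p r t.
  have : 0 <= (cross p q r - 6 / 25) * (cross p s t - 6 / 25).
    by apply: mulr_ge0; lra.
  have : 0 <= (cross p q t - 6 / 25) * M by apply: mulr_ge0; lra.
  lra.
have M0 : 0 < M by lra.
have M_ge : 6 / 25 <= M by nra.
(* The chord condition becomes 6/25 <= [cross r s t], or 6/25 <= [cross q r s] in the mirrored
   case. *)
pose l := 6 / 25 / M.
have lM : l * M = 6 / 25 by rewrite /l divfK ?gt_eqF.
have l01 : 0 <= l <= 1.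
  apply/andP; split; first by apply: divr_ge0; lra.
  by rewrite ler_pdivrMr // mul1r.
clearbody l.
have [le_st|lt_st] := lerP (cross p q s) (cross p r t).
- have hsh : simplex (shift t l p r).
    by apply: (@simplex_shift_last p r s t) => //; rewrite -?/M ?lM; lra.
  have [e he le_e] := trapezoid_le l01 hp hr ht hq hsh.
  apply: (@pentagon_num_false (cross p r t) M e l) => //; try lra.
    by apply: le_trans prod_ge _; rewrite expr2 ler_pM2r.
  have : 0 <= (1 - l) * (cross p q r - 6 / 25) by apply: mulr_ge0; lra.
  have prq : cross p r q = - cross p q r by rewrite /cross; ring.
  by rewrite prq in le_e; lra.
- have hsh : simplex (shift q l p s).
    by apply: (@simplex_shift_third s p q r) => //;
      rewrite ?(cross_rot p q s, cross_rot p r s, cross_rot q r s) -?/M ?lM; lra.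
  have [e he le_e] := trapezoid_ge l01 hp hs hq ht hsh.
  apply: (@pentagon_num_false (cross p q s) M e l) => //; try lra.
    by apply: le_trans prod_ge _; rewrite expr2 ler_pM2l // ltW.
  have : 0 <= (1 - l) * (cross p s t - 6 / 25) by apply: mulr_ge0; lra.
  have psq : cross p s q = - cross p q s by rewrite /cross; ring.
  by rewrite psq in le_e; lra.
Qed.

Lemma pentagon_false p q r s t :
    simplex p -> simplex q -> simplex r -> simplex s -> simplex t ->
    6 / 25 < cross p q r -> 6 / 25 < cross p q s -> 6 / 25 < cross p q t ->
    6 / 25 < cross p r s -> 6 / 25 < cross p r t -> 6 / 25 < cross p s t ->
    6 / 25 < cross q r s -> 6 / 25 < cross q r t -> 6 / 25 < cross q s t ->
    6 / 25 < cross r s t ->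
  False.
Proof.
move=> hp hq hr hs ht pqr pqs pqt prs prt pst qrs qrt qst rst.
have m0 : 0 < (6 / 25 : R) by lra.
have maxp : cross p q s <= cross p r s -> cross p r t <= cross p r s -> False.
  by move=> h1 h2; apply: (@pentagon_max_false p q r s t) => //; lra.
have maxq : cross q r t <= cross q s t -> cross p q s <= cross q s t -> False.
  by move=> h1 h2; apply: (@pentagon_max_false q r s t p) => //;
    rotate_to p => //; lra.
have maxr : cross p r s <= cross p r t -> cross q r t <= cross p r t -> False.
  by move=> h1 h2; apply: (@pentagon_max_false r s t p q) => //;
    rotate_to q; rotate_to p => //; lra.
have maxs : cross q s t <= cross p q s -> cross p r s <= cross p q s -> False.
  by move=> h1 h2; apply: (@pentagon_max_false s t p q r) => //;
    rotate_to r; rotate_to q; rotate_to p => //; lra.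
have maxt : cross p r t <= cross q r t -> cross q s t <= cross q r t -> False.
  by move=> h1 h2; apply: (@pentagon_max_false t p q r s) => //;
    rotate_to s; rotate_to r; rotate_to q; rotate_to p => //; lra.
(* Cyclic neighbours in this list share a diagonal; a maximal entry beats both of its neighbours,
   which is all that its case needs. *)
pose M (i : 'I_5) :=
  [:: cross p q s; cross p r s; cross p r t; cross q r t; cross q s t]`_i.
have [i _ maxM] := @arg_maxP _ _ _ ord0 xpredT M isT.
have {}maxM k (k5 : (k < 5)%N) : M (Ordinal k5) <= M i by apply: maxM.
case: i maxM => -[|[|[|[|[|//]]]]] i5 maxM.
- by apply: maxs; [apply: (maxM 4%N) | apply: (maxM 1%N)].
- by apply: maxp; [apply: (maxM 0%N) | apply: (maxM 2%N)].
- by apply: maxr; [apply: (maxM 1%N) | apply: (maxM 3%N)].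
- by apply: maxt; [apply: (maxM 2%N) | apply: (maxM 4%N)].
- by apply: maxq; [apply: (maxM 3%N) | apply: (maxM 0%N)].
Qed.

(* The second interior point lies in one of the three triangles around the
   first one, which therefore splits again. *)
Lemma two_inside_false a b c d e :
    simplex a -> simplex b -> simplex c ->
    6 / 25 < cross a b d -> 6 / 25 < cross b c d -> 6 / 25 < cross c a d ->
    6 / 25 < cross a b e -> 6 / 25 < cross b c e -> 6 / 25 < cross c a e ->
    6 / 25 < `|cross d a e| -> 6 / 25 < `|cross d b e| ->
    6 / 25 < `|cross d c e| ->
  False.
Proof.
move=> ha hb hc abd bcd cad abe bce cae.
rewrite !ltr_normr => dae dbe dce.
have S : cross a b c <= 1.
  have := pentagon_area_le1 ha hb hc hc hc; rewrite /pentagon_area.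
  by rewrite (_ : cross a c c = 0) ?addr0 // /cross; ring.
have Sd : cross a b d + cross b c d + cross c a d = cross a b c.
  by rewrite /cross; ring.
have Sa : cross d a e + cross a b e - cross d b e = cross a b d.
  by rewrite /cross; ring.
have Sb : cross d b e + cross b c e - cross d c e = cross b c d.
  by rewrite /cross; ring.
have Sc : cross d c e + cross c a e - cross d a e = cross c a d.
  by rewrite /cross; ring.
(* [d] is the barycentre of [a], [b], [c] with these weights, so the three signs are not all equal.
   A positive one followed cyclically by a negative one makes one of the three triangles around [d]
   exceed 18/25, and [cross a b c] exceed 30/25. *)
have balance : cross b c d * cross d a e + cross c a d * cross d b e
    + cross a b d * cross d c e = 0 by rewrite /cross; ring.
have posM (x y : R) : 6 / 25 < x -> 6 / 25 < y -> 0 < x * y.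
  by move=> ? ?; apply: mulr_gt0; lra.
case/orP: dae => dae; case/orP: dbe => dbe; case/orP: dce => dce; try lra.
- by have := posM _ _ bcd dae; have := posM _ _ cad dbe;
    have := posM _ _ abd dce; lra.
- by have := posM _ _ bcd dae; have := posM _ _ cad dbe;
    have := posM _ _ abd dce; lra.
Qed.

(** [c a e b] is a convex quadrilateral around [d]. The position of [d] relative to the diagonal
    [c e] decides whether [b c] or [c a] is the side with two triangles containing [d]. *)
Lemma inside_quad_false a b c d e :
    simplex a -> simplex b -> simplex c -> simplex e ->
    6 / 25 < cross a b d -> 6 / 25 < cross b c d -> 6 / 25 < cross c a d ->
    6 / 25 < - cross a b e -> 6 / 25 < cross b c e -> 6 / 25 < cross c a e ->
    6 / 25 < `|cross c e d| -> 6 / 25 < `|cross e b d| ->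
    6 / 25 < `|cross a e d| ->
  False.
Proof.
move=> ha hb hc he abd bcd cad abe bce cae.
rewrite !ltr_normr => ced ebd aed.
have Sd : cross a b d + cross b c d + cross c a d = cross a b c.
  by rewrite /cross; ring.
have abc : 18 / 25 < cross a b c by lra.
have posM (x y : R) : 6 / 25 < x -> 6 / 25 < y -> 0 < x * y.
  by move=> ? ?; apply: mulr_gt0; lra.
have {ebd} ebd : 6 / 25 < cross e b d.
  have : 0 < cross a b c * cross e b d.
    have -> : cross a b c * cross e b d
        = cross b c d * - cross a b e + cross a b d * cross b c e.
      by rewrite /cross; ring.
    by apply: addr_gt0; apply: posM.
  by rewrite pmulr_rgt0; last lra; case/orP: ebd; lra.
have {aed} aed : 6 / 25 < cross a e d.
  have : 0 < cross a b c * cross a e d.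
    have -> : cross a b c * cross a e d
        = cross c a d * - cross a b e + cross a b d * cross c a e.
      by rewrite /cross; ring.
    by apply: addr_gt0; apply: posM.
  by rewrite pmulr_rgt0; last lra; case/orP: aed; lra.
case/orP: ced => ced.
- have Se : cross b c e = cross c e d + cross e b d + cross b c d.
    by rewrite /cross; ring.
  by apply: (@quad_false b c a e) => //; crosses.
- have Se : cross c a e = cross c a d + cross a e d - cross c e d.
    by rewrite /cross; ring.
  by apply: (@quad_false c a e b) => //; crosses.
Qed.

End SimplexPoints.

Ltac distinct U :=
  move: U; rewrite /= !inE !negb_or ?andbT;
  repeat (let H := fresh in case/andP; move=> H);
  repeat match goal with H : is_true (_ && _) |- _ =>
    let H1 := fresh in let H2 := fresh in case/andP: H => H1 H2 end;
  move=> *; repeat (apply/andP; split); first [done | by rewrite eq_sym].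

(** * Orientations of the five points *)

Section Configuration.
Variables (R : realFieldType) (I : eqType) (pt : I -> R * R).
Hypothesis simplex_pt : forall i, simplex (pt i).
Hypothesis wide : forall i j k, i != j -> i != k -> j != k ->
  6 / 25 < `|cross (pt i) (pt j) (pt k)|.
Implicit Types i j k a b c d e : I.

Local Notation D i j k := (cross (pt i) (pt j) (pt k)).

Lemma wide_gt0 i j k : uniq [:: i; j; k] -> 0 < D i j k -> 6 / 25 < D i j k.
Proof.
rewrite /= !inE negb_or !andbT => /andP[/andP[ij ik] jk] Dgt0.
by have := wide ij ik jk; rewrite gtr0_norm.
Qed.

Lemma wide_lt0 i j k : uniq [:: i; j; k] -> D i j k < 0 -> 6 / 25 < - D i j k.
Proof.
rewrite /= !inE negb_or !andbT => /andP[/andP[ij ik] jk] Dlt0.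
by have := wide ij ik jk; rewrite ltr0_norm.
Qed.

Lemma wide_sign i j k : uniq [:: i; j; k] -> 0 < D i j k \/ D i j k < 0.
Proof.
rewrite /= !inE negb_or !andbT => /andP[/andP[ij ik] jk].
have := wide ij ik jk; case: (ltgtP (D i j k) 0) => [|_|->]; [by right|by left|].
by rewrite normr0; lra.
Qed.

Lemma nested_two_false a b c d e : uniq [:: a; b; c; d; e] ->
    0 < D a b d -> 0 < D b c d -> 0 < D c a d ->
    0 < D a b e -> 0 < D b c e -> 0 < D c a e ->
  False.
Proof.
move=> U abd bcd cad abe bce cae.
apply: (@two_inside_false R (pt a) (pt b) (pt c) (pt d) (pt e)) => //;
  try (apply: wide_gt0 => //; distinct U); apply: wide; distinct U.
Qed.

Lemma nested_beside_false a b c d e : uniq [:: a; b; c; d; e] ->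
    0 < D a b d -> 0 < D b c d -> 0 < D c a d ->
    D a b e < 0 -> 0 < D b c e -> 0 < D c a e ->
  False.
Proof.
move=> U abd bcd cad abe bce cae.
apply: (@inside_quad_false R (pt a) (pt b) (pt c) (pt d) (pt e)) => //;
  try (apply: wide_gt0 => //; distinct U);
  try (apply: wide_lt0 => //; distinct U); apply: wide; distinct U.
Qed.

(* Here [a] and [d] are both inside the triangle [b c e]. *)
Lemma nested_behind_false a b c d e : uniq [:: a; b; c; d; e] ->
    0 < D a b d -> 0 < D b c d -> 0 < D c a d ->
    D a b e < 0 -> 0 < D b c e -> D c a e < 0 ->
  False.
Proof.
move=> U abd bcd cad abe bce cae.
have abc : 0 < D a b c.
  have -> : D a b c = D a b d + D b c d + D c a d by rewrite /cross; ring.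
  lra.
apply: (@nested_two_false b c e a d);
  [distinct U | crosses | crosses | crosses | done | |].
- rewrite -(pmulr_rgt0 _ abc).
  have -> : D a b c * D c e d = D b c d * - D c a e + D c a d * D b c e.
    by rewrite /cross; ring.
  by apply: addr_gt0; apply: mulr_gt0 => //; rewrite oppr_gt0.
- rewrite -(pmulr_rgt0 _ abc).
  have -> : D a b c * D e b d = D b c d * - D a b e + D a b d * D b c e.
    by rewrite /cross; ring.
  by apply: addr_gt0; apply: mulr_gt0 => //; rewrite oppr_gt0.
Qed.

(** Up to rotation, [e] is on the negative side of no, one or two sides of [a b c], each excluded
    above; three would contradict [S]. *)
Lemma nested_false a b c d e : uniq [:: a; b; c; d; e] ->
  0 < D a b d -> 0 < D b c d -> 0 < D c a d -> False.
Proof.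
move=> U abd bcd cad.
have Ubca : uniq [:: b; c; a; d; e] by distinct U.
have Ucab : uniq [:: c; a; b; d; e] by distinct U.
have S : D a b d + D b c d + D c a d = D a b e + D b c e + D c a e.
  by rewrite /cross; ring.
have [abe|abe] : 0 < D a b e \/ D a b e < 0 by apply: wide_sign; distinct U.
  have [bce|bce] : 0 < D b c e \/ D b c e < 0 by apply: wide_sign; distinct U.
    have [cae|cae] : 0 < D c a e \/ D c a e < 0 by apply: wide_sign; distinct U.
      exact: (nested_two_false U).
    exact: (nested_beside_false Ucab).
  have [cae|cae] : 0 < D c a e \/ D c a e < 0 by apply: wide_sign; distinct U.
    exact: (nested_beside_false Ubca).
  exact: (nested_behind_false Ucab).
have [bce|bce] : 0 < D b c e \/ D b c e < 0 by apply: wide_sign; distinct U.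
  have [cae|cae] : 0 < D c a e \/ D c a e < 0 by apply: wide_sign; distinct U.
    exact: (nested_beside_false U).
  exact: (nested_behind_false U).
have [cae|cae] : 0 < D c a e \/ D c a e < 0 by apply: wide_sign; distinct U.
  exact: (nested_behind_false Ubca).
lra.
Qed.

(** With no negative sign [d] is inside [a b c]; with two, a vertex is inside the triangle of [d]
    and the other two. [nested_false] excludes both, and [S] excludes three. *)
Lemma sees_one_side a b c d e : uniq [:: a; b; c; d; e] -> 0 < D a b c ->
  [\/ [/\ D a b d < 0, 0 < D b c d & 0 < D c a d],
      [/\ 0 < D a b d, D b c d < 0 & 0 < D c a d]
    | [/\ 0 < D a b d, 0 < D b c d & D c a d < 0] ].
Proof.
move=> U abc.
have S : D a b c = D a b d + D b c d + D c a d by rewrite /cross; ring.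
have [abd|abd] : 0 < D a b d \/ D a b d < 0 by apply: wide_sign; distinct U.
  have [bcd|bcd] : 0 < D b c d \/ D b c d < 0 by apply: wide_sign; distinct U.
    have [cad|cad] : 0 < D c a d \/ D c a d < 0 by apply: wide_sign; distinct U.
      by have := nested_false U abd bcd cad.
    by apply: Or33.
  have [cad|cad] : 0 < D c a d \/ D c a d < 0 by apply: wide_sign; distinct U.
    by apply: Or32.
  by case: (@nested_false a b d c e); [distinct U | crosses | crosses | crosses].
have [bcd|bcd] : 0 < D b c d \/ D b c d < 0 by apply: wide_sign; distinct U.
  have [cad|cad] : 0 < D c a d \/ D c a d < 0 by apply: wide_sign; distinct U.
    by apply: Or31.
  by case: (@nested_false b c d a e); [distinct U | crosses | crosses | crosses].
have [cad|cad] : 0 < D c a d \/ D c a d < 0 by apply: wide_sign; distinct U.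
  by case: (@nested_false c a d b e); [distinct U | crosses | crosses | crosses].
lra.
Qed.

Lemma convex_pentagon_false a b c d e : uniq [:: a; b; c; d; e] ->
    0 < D a b c -> 0 < D a b d -> 0 < D a b e -> 0 < D a c d -> 0 < D a c e ->
    0 < D a d e -> 0 < D b c d -> 0 < D b c e -> 0 < D b d e -> 0 < D c d e ->
  False.
Proof.
move=> U *.
by apply: (@pentagon_false R (pt a) (pt b) (pt c) (pt d) (pt e)) => //;
  apply: wide_gt0 => //; distinct U.
Qed.

(** [e] is on the same side of the diagonal [a c] as [d], so it lies beyond [c d] or [d a];
    inserting it there yields a convex pentagon. *)
Lemma quad_side_false a b c d e : uniq [:: a; b; c; d; e] ->
  0 < D a b c -> 0 < D b c d -> 0 < D a c d -> 0 < D a b d -> 0 < D a c e ->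
  False.
Proof.
move=> U abc bcd acd abd ace.
have cda : 0 < D c d a by crosses.
have dab : 0 < D d a b by crosses.
have cae : D c a e = - D a c e by rewrite cross_swap.
have Uabc : uniq [:: a; b; c; e; d] by distinct U.
have Ucda : uniq [:: c; d; a; e; b] by distinct U.
have Ubcd : uniq [:: b; c; d; e; a] by distinct U.
have Udab : uniq [:: d; a; b; e; c] by distinct U.
have [abe bce] : 0 < D a b e /\ 0 < D b c e.
  by case: (sees_one_side Uabc abc) => -[? ? ?]; split=> //; lra.
have [[cde dae _]|[cde dae _]|[_ _]] := sees_one_side Ucda cda; last lra.
- apply: (@convex_pentagon_false a b c e d) => //; try crosses.
  by case: (sees_one_side Ubcd bcd) => -[? ? ?]; try lra; crosses.
- apply: (@convex_pentagon_false a b c d e) => //; try crosses.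
  by case: (sees_one_side Udab dab) => -[? ? ?]; try lra; crosses.
Qed.

(** Relabelling the quadrilateral as [c d a b] exchanges the two sides of the diagonal [a c]. *)
Lemma convex_quad_false a b c d e : uniq [:: a; b; c; d; e] ->
  0 < D a b c -> 0 < D a b d -> 0 < D b c d -> D c a d < 0 -> False.
Proof.
move=> U abc abd bcd cad.
have acd : 0 < D a c d by crosses.
have [ace|ace] : 0 < D a c e \/ D a c e < 0 by apply: wide_sign; distinct U.
  exact: (quad_side_false U).
by apply: (@quad_side_false c d a b e); [distinct U|crosses..].
Qed.

Lemma no_wide_five a b c d e : uniq [:: a; b; c; d; e] -> False.
Proof.
wlog abc : a b / 0 < D a b c => [wlog U|U].
  have [abc|abc] : 0 < D a b c \/ D a b c < 0 by apply: wide_sign; distinct U.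
    exact: wlog abc U.
  by apply: (wlog b a); [crosses | distinct U].
have [[? ? ?]|[? ? ?]|[? ? ?]] := sees_one_side U abc.
- by apply: (@convex_quad_false b c a d e); [distinct U|crosses| | |].
- by apply: (@convex_quad_false c a b d e); [distinct U|crosses| | |].
- exact: (convex_quad_false U).
Qed.
End Configuration.

(** * Passage to barycentric coordinates of T *)

Theorem theorem2p1 (R : realType) (a b c : 'rV[R]_2)
    (area_abc : triangle_area a b c = 1)
    (p : 'I_5 -> 'rV[R]_2) (p_in : forall i, triangle a b c (p i)) :
  exists i j k : 'I_5,
    [/\ i != j, i != k, j != k
      & triangle_area (p i) (p j) (p k) <= 6 / 25].
Proof.
have bary i : exists xy : R * R, simplex xy /\
    p i = a + xy.1 *: (b - a) + xy.2 *: (c - a).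
  have [u [v [w [u0 v0 w0 uvw ->]]]] := p_in i.
  exists (v, w); split; first by split=> //=; lra.
  have -> : u = 1 - v - w by lra.
  by apply/rowP => k; rewrite !mxE /=; ring.
have {bary} [pt /all_and2[simplex_pt pE]] := fin_all_exists bary.
have areaE i j k :
    triangle_area (p i) (p j) (p k) = `|cross (pt i) (pt j) (pt k)|.
  (* The factor 1 is written as the area of [a b c], by which the barycentric parametrization scales
     [cross]. *)
  rewrite -[RHS]mulr1 -area_abc /triangle_area mulrA -normrM.
  by rewrite !pE !mxE /cross; congr (`|_| / 2); ring.
(* Over the finite type of indices the claim is a boolean, so its negation can be assumed. *)
have [/existsP[i /existsP[j /existsP[k /and4P[ij ik jk le_ijk]]]]|no_thin] :=
    boolP [exists i : 'I_5, exists j : 'I_5, exists k : 'I_5,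
      [&& i != j, i != k, j != k & triangle_area (p i) (p j) (p k) <= 6 / 25]].
  by exists i, j, k.
have wide i j k : i != j -> i != k -> j != k ->
    6 / 25 < `|cross (pt i) (pt j) (pt k)|.
  move=> ij ik jk; rewrite -areaE ltNge; apply: contra no_thin => le_ijk.
  by apply/existsP; exists i; apply/existsP; exists j; apply/existsP; exists k;
    rewrite ij ik jk.
by case: (@no_wide_five _ _ pt simplex_pt wide (inord 0) (inord 1) (inord 2)
  (inord 3) (inord 4)); rewrite /= !inE -!val_eqE /= !inordK.
Qed.
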